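(* Let $k$ be an algebraically closed field. If $E$ is a finite fractional Brauer configuration of type MS with integral f-degree, then $A_E$ is (isomorphic to) a Brauer configuration algebra. Conversely, each Brauer configuration algebra is isomorphic to a fractional Brauer configuration algebra $A_E$, where $E$ is a finite fractional Brauer configuration of type MS with integral f-degree.
   Context: Fractional Brauer configuration. Let $G=\langle g\rangle$ be an infinite cyclic group. A fractional Brauer configuration (f-BC) is a quadruple $E=(E,P,L,d)$, where $E$ is a $G$-set, $P$ and $L$ are two partitions of $E$ ($P(e)$ and $L(e)$ denote the classes containing $e$), and $d:E\to\mathbb{Z}_{+}$ is a function to the positive integers, such that: (f1) $L(e)\subseteq P(e)$ and $P(e)$ is finite for each $e\in E$; (f2) if $L(e_1)=L(e_2)$ then $P(g\cdot e_1)=P(g\cdot e_2)$; (f3) if $e_1,e_2$ lie in the same $\langle g\rangle$-orbit then $d(e_1)=d(e_2)$; (f4) $P(e_1)=P(e_2)$ if and only if $P(g^{d(e_1)}\cdot e_1)=P(g^{d(e_2)}\cdot e_2)$; (f5) $L(e_1)=L(e_2)$ if and only if $L(g^{d(e_1)}\cdot e_1)=L(g^{d(e_2)}\cdot e_2)$; (f6) for all $e,h\in E$ the formal sequence $L(g^{d(e)-1}\cdot e)\cdots L(g\cdot e)L(e)$ is not a proper subsequence (of consecutive terms) of the formal sequence $L(g^{d(h)-1}\cdot h)\cdots L(g\cdot h)L(h)$. $E$ is finite if the set $E$ is finite; $E$ is of type MS if $L(e)=\{e\}$ for every $e\in E$. The f-degree of a finite $\langle g\rangle$-orbit $v=G\cdot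 e$ is $d(e)/|v|$; $E$ has integral f-degree if all its f-degrees are integers. Algebra $A_E$. $Q_E$ is the quiver with vertices $P(e)$ and arrows $L(e):P(e)\to P(g\cdot e)$ ($e\in E$); paths are written right to left. $I_E$ is the ideal of the path category $kQ_E$ generated by: (fR1) $L(g^{d(e)-1-k}\cdot e)\cdots L(e)-L(g^{d(h)-1-k}\cdot h)\cdots L(h)$, where $0\le k\le\min\{d(e),d(h)\}$ is an integer, $P(e)=P(h)$ and $L(g^{d(e)-i}\cdot e)=L(g^{d(h)-i}\cdot h)$ for $1\le i\le k$; (fR2) paths $L(e_n)\cdots L(e_1)$ with $n>1$ and $\bigcap_{i=1}^n g^{n-i}\cdot L(e_i)=\emptyset$; (fR3) paths $L(g^{n-1}\cdot e)\cdots L(g\cdot e)L(e)$ with $n>d(e)$. $\Lambda_E=kQ_E/I_E$ and $A_E=\big(\bigoplus_{x,y\in (Q_E)_0}\Lambda_E(x,y)\big)^{op}$ is the fractional Brauer configuration algebra of $E$. Brauer configuration algebras. A Brauer configuration is a tuple $\Delta=(\Delta_0,\Delta_1,\zeta,P,\mathfrak p,\nu)$ where $\Delta_0$ (vertices) and $\Delta_1$ (angles) are finite sets, $\zeta:\Delta_1\to\Delta_0$ is surjective, $P$ is a partition of $\Delta_1$ with $|P(e)|\ge2$ for all $e$, $\mathfrak p$ is a permutation of $\Delta_1$ whose cycles have underlying sets $\zeta^{-1}(\alpha)$, $\alpha\in\Delta_0$, $\nu:\Delta_0\to\mathbb Z_{+}$ is a function, and for every class $P(e)$ there is $h\in P(e)$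 with $|\zeta^{-1}(\zeta(h))|\cdot\nu(\zeta(h))>1$. Its quiver $Q_\Delta$ has the classes of $P$ as vertices, and for every angle $e\in\Delta_1$ an arrow (also denoted $e$) from $P(e)$ to $P(\mathfrak p(e))$. For an arrow $e$ let $p(e)=\mathfrak p^{n-1}(e)\cdots\mathfrak p(e)e$, with $n$ minimal positive such that $\mathfrak p^n(e)=e$. $I_\Delta$ is the ideal of the path algebra $kQ_\Delta$ (paths written right to left) generated by (R1) $p(e)^{\nu(\zeta(e))}-p(h)^{\nu(\zeta(h))}$ for arrows $e,h$ with $P(e)=P(h)$, and (R2) $e_2e_1$ for arrows with $e_2\ne\mathfrak p(e_1)$ (whenever composable). The Brauer configuration algebra of $\Delta$ is $kQ_\Delta/I_\Delta$.
   Formalization: In the first half, the Brauer configuration is shown to satisfy its last axiom only if every class P(e) contains some h with d(h)>1; otherwise A_E has a block k[x]/(x^2), as for E={e}, d(e)=1, and is not a Brauer configuration algebra. *)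

(* Defs.v *)
From HB Require Import structures.
From mathcomp Require Import all_boot all_order all_fingroup all_algebra.
From mathcomp Require Import ring_quotient generic_quotient finmap.
From mathcomp Require Import boolp monalg.

Set Implicit Arguments.
Unset Strict Implicit.
Unset Printing Implicit Defensive.

Import GRing.Theory.
Local Open Scope ring_scope.

Record quiver := Quiver {
  vertex : finType;
  arrow : finType;
  source : arrow -> vertex;
  target : arrow -> vertex
}.

Section Paths.
Variable Q : quiver.

(* [is_path x [:: a1; ...; an]] : the arrows a1, ..., an can be traversed in  *)
(* this order starting from the vertex x.  In right-to-left notation this is  *)
(* the path an ... a1 (the trivial path at x when n = 0).                     *)
Fixpoint is_path (x : vertex Q) (s : seq (arrow Q)) : bool :=
  if s is a :: s' then (source a == x) && is_path (target a) s' else true.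

Fixpoint path_end (x : vertex Q) (s : seq (arrow Q)) : vertex Q :=
  if s is a :: s' then path_end (target a) s' else x.

Definition qpath := {p : vertex Q * seq (arrow Q) | is_path p.1 p.2}.

Definition qsource (p : qpath) : vertex Q := (val p).1.
Definition qarrows (p : qpath) : seq (arrow Q) := (val p).2.
Definition qtarget (p : qpath) : vertex Q := path_end (qsource p) (qarrows p).

Lemma is_path_cat x s t :
  is_path x (s ++ t) = is_path x s && is_path (path_end x s) t.
Proof. by elim: s x => //= a s IHs x; rewrite IHs andbA. Qed.

Lemma path_end_cat x s t : path_end x (s ++ t) = path_end (path_end x s) t.
Proof. by elim: s x => /=. Qed.

End Paths.

Definition path_alg (k : fieldType) (Q : quiver) := {malg k[qpath Q]}.

HB.instance Definition _ (k : fieldType) (Q : quiver) :=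
  GRing.Zmodule.on (path_alg k Q).

(* The scaling of [malg], sealed: failing conversion tests that unfold the    *)
(* one of [malg] do not terminate in practice.                                *)
HB.lock Definition path_scale (k : fieldType) (Q : quiver)
    (c : k) (f : path_alg k Q) : path_alg k Q :=
  c *: (f : {malg k[qpath Q]}).

Section PathScale.
Variables (k : fieldType) (Q : quiver).
Local Notation path_alg := (path_alg k Q).

Lemma mcoeff_path_scale c (f : path_alg) p : (path_scale c f)@_p = c * f@_p.
Proof. by rewrite path_scale.unlock; apply: mcoeffZ. Qed.

Fact path_scaleA a b (f : path_alg) :
  path_scale a (path_scale b f) = path_scale (a * b) f.
Proof. by rewrite path_scale.unlock scalerA. Qed.

Fact path_scale1 : left_id 1 (@path_scale k Q).
Proof. by move=> f; rewrite path_scale.unlock scale1r. Qed.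

Fact path_scaleDr : right_distributive (@path_scale k Q) +%R.
Proof. by move=> c f g; rewrite path_scale.unlock; apply: scalerDr. Qed.

Fact path_scaleDl (f : path_alg) : {morph (@path_scale k Q)^~ f : a b / a + b}.
Proof. by move=> a b; rewrite path_scale.unlock; apply: scalerDl. Qed.

HB.instance Definition _ := GRing.Zmodule_isLmodule.Build k path_alg
  path_scaleA path_scale1 path_scaleDr path_scaleDl.

Lemma mcoeff_pathZ c (f : path_alg) p : (c *: f)@_p = c * f@_p.
Proof. exact: mcoeff_path_scale. Qed.

Lemma msupp_pathZ_le c (f : path_alg) : (msupp (c *: f) `<=` msupp f)%fset.
Proof.
apply/fsubsetP => p; rewrite -!mcoeff_neq0 mcoeff_pathZ.
by apply: contraNneq => ->; rewrite mulr0.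
Qed.

End PathScale.

(* The basis element attached to a path; 0 if the arrows do not compose.      *)
HB.lock Definition path_elt (k : fieldType) (Q : quiver)
    (x : vertex Q) (s : seq (arrow Q)) : path_alg k Q :=
  if insub (x, s) is Some p then << (p : qpath Q) >> else 0.

(* The product pq of two paths: first q, then p.                              *)
Definition qpath_mul (k : fieldType) (Q : quiver) (p q : qpath Q) :
    path_alg k Q :=
  if qtarget q == qsource p
  then path_elt k (qsource q) (qarrows q ++ qarrows p) else 0.

HB.lock Definition path_mul (k : fieldType) (Q : quiver)
    (f g : path_alg k Q) : path_alg k Q :=
  \sum_(p <- msupp f) \sum_(q <- msupp g) (f@_p * g@_q) *: qpath_mul k p q.

Section PathAlgebra.
Variables (k : fieldType) (Q : quiver).
Local Notation path_alg := (path_alg k Q).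
Local Notation path_elt := (@path_elt k Q).
Local Notation qpath_mul := (@qpath_mul k Q).

Definition path_one : path_alg := \sum_(x : vertex Q) path_elt x [::].

Lemma path_eltN x s : ~~ is_path x s -> path_elt x s = 0.
Proof. by move=> sN; rewrite path_elt.unlock insubF //; apply: negbTE. Qed.

Lemma path_mulE (f g : path_alg) : path_mul f g =
  \sum_(p <- msupp f) \sum_(q <- msupp g) (f@_p * g@_q) *: qpath_mul p q.
Proof. by rewrite path_mul.unlock. Qed.

Lemma path_eltE (p : qpath Q) : path_elt (qsource p) (qarrows p) = << p >>.
Proof. by case: p => -[x s] ps; rewrite path_elt.unlock insubT. Qed.

Lemma path_elt_ok x s (sP : is_path x s) :
  path_elt x s = << (Sub (x, s) sP : qpath Q) >>.
Proof. by rewrite path_elt.unlock insubT. Qed.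

Lemma path_mulEw (d1 d2 : {fset qpath Q}) (f g : path_alg) :
    (msupp f `<=` d1)%fset -> (msupp g `<=` d2)%fset ->
  path_mul f g = \sum_(p <- d1) \sum_(q <- d2) (f@_p * g@_q) *: qpath_mul p q.
Proof.
move=> le1 le2; rewrite path_mulE (big_fset_incl _ le1) /=.
  apply: eq_bigr => p _; apply: big_fset_incl => // q _ /mcoeff_outdom ->.
  by rewrite mulr0 scale0r.
move=> p _ /mcoeff_outdom fp.
by rewrite big1 // => q _; rewrite fp mul0r scale0r.
Qed.

Lemma path_mulDl : left_distributive (@path_mul k Q) +%R.
Proof.
move=> f g h; set d := (msupp f `|` msupp g)%fset.
rewrite (@path_mulEw d (msupp h)) ?msuppD_le ?fsubset_refl //.
rewrite (@path_mulEw d (msupp h) f) ?fsubsetUl ?fsubset_refl //.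
rewrite (@path_mulEw d (msupp h) g) ?fsubsetUr ?fsubset_refl //.
rewrite -big_split; apply: eq_bigr => p _; rewrite -big_split /=.
by apply: eq_bigr => q _; rewrite mcoeffD mulrDl scalerDl.
Qed.

Lemma path_mulDr : right_distributive (@path_mul k Q) +%R.
Proof.
move=> h f g; set d := (msupp f `|` msupp g)%fset.
rewrite (@path_mulEw (msupp h) d) ?msuppD_le ?fsubset_refl //.
rewrite (@path_mulEw (msupp h) d h f) ?fsubsetUl ?fsubset_refl //.
rewrite (@path_mulEw (msupp h) d h g) ?fsubsetUr ?fsubset_refl //.
rewrite -big_split; apply: eq_bigr => p _; rewrite -big_split /=.
by apply: eq_bigr => q _; rewrite mcoeffD mulrDr scalerDl.
Qed.

Lemma path_mul0l (f : path_alg) : path_mul 0 f = 0.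
Proof. by rewrite path_mulE msupp0 big_seq_fset0. Qed.

Lemma path_mul0r (f : path_alg) : path_mul f 0 = 0.
Proof. by rewrite path_mulE big1 // => p _; rewrite msupp0 big_seq_fset0. Qed.

Lemma path_mulZl c (f g : path_alg) : path_mul (c *: f) g = c *: path_mul f g.
Proof.
rewrite (path_mulEw (msupp_pathZ_le c f) (fsubset_refl _)) path_mulE scaler_sumr.
apply: eq_bigr => p _; rewrite scaler_sumr.
by apply: eq_bigr => q _; rewrite mcoeff_pathZ scalerA mulrA.
Qed.

Lemma path_mulZr c (f g : path_alg) : path_mul f (c *: g) = c *: path_mul f g.
Proof.
rewrite (path_mulEw (fsubset_refl _) (msupp_pathZ_le c g)) path_mulE scaler_sumr.
apply: eq_bigr => p _; rewrite scaler_sumr.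
by apply: eq_bigr => q _; rewrite mcoeff_pathZ scalerA mulrCA.
Qed.

Lemma path_mulUU p q :
  path_mul (<< p >> : path_alg) (<< q >> : path_alg) = qpath_mul p q.
Proof.
rewrite (path_mulEw msuppU_le msuppU_le) !big_seq_fset1.
by rewrite !mcoeffUU mulr1 scale1r.
Qed.

Lemma path_mul_elt x s y t : is_path x s -> is_path y t ->
  path_mul (path_elt y t) (path_elt x s) =
    if path_end x s == y then path_elt x (s ++ t) else 0.
Proof.
by move=> sP tP; rewrite (path_elt_ok sP) (path_elt_ok tP) path_mulUU.
Qed.

Lemma path_decomp (f : path_alg) : f = \sum_(p <- msupp f) f@_p *: (<< p >> : path_alg).
Proof.
rewrite [LHS]monalgE; apply: eq_bigr => p _; apply: (proj1 (malgP _ _)) => q.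
have e1 := @mcoeffU (qpath Q) k p (f@_p) q.
have e2 := @mcoeffU (qpath Q) k p 1 q.
rewrite [RHS]mcoeff_pathZ.
refine (etrans e1 (etrans _ (esym (congr1 (fun z => f@_p * z) e2)))).
by rewrite mulr_natr.
Qed.

Lemma path_alg_ind (P : path_alg -> Prop) :
  P 0 -> (forall f g, P f -> P g -> P (f + g)) ->
  (forall c f, P f -> P (c *: f)) ->
  (forall p, P (path_elt (qsource p) (qarrows p))) -> forall f, P f.
Proof.
move=> P0 PD PZ PU f; rewrite [f]path_decomp.
elim/big_ind: _ => // p _; apply: PZ; rewrite -path_eltE; exact: PU.
Qed.

Fact path_mulA : associative (@path_mul k Q).
Proof.
move=> f g h.
elim/path_alg_ind: f => [|f f' If If'|c f If|p].
- by rewrite !path_mul0l.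
- by rewrite !path_mulDl If If'.
- by rewrite !path_mulZl If.
elim/path_alg_ind: g => [|f f' If If'|c f If|q].
- by rewrite path_mul0l !path_mul0r path_mul0l.
- by rewrite path_mulDl !path_mulDr path_mulDl If If'.
- by rewrite path_mulZl !path_mulZr path_mulZl If.
elim/path_alg_ind: h => [|f f' If If'|c f If|r].
- by rewrite !path_mul0r.
- by rewrite !path_mulDr If If'.
- by rewrite !path_mulZr If.
have pP : is_path (qsource p) (qarrows p) := valP p.
have qP : is_path (qsource q) (qarrows q) := valP q.
have rP : is_path (qsource r) (qarrows r) := valP r.
rewrite !path_mul_elt //.
case: (eqVneq (path_end (qsource r) (qarrows r)) (qsource q)) => [er|nr].
  have rqP : is_path (qsource r) (qarrows r ++ qarrows q).
    by rewrite is_path_cat er; apply/andP.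
  rewrite path_mul_elt // path_end_cat er.
  case: eqP => [eq|_]; last by rewrite path_mul0l.
  rewrite path_mul_elt ?er ?eqxx ?catA // is_path_cat eq; exact/andP.
rewrite path_mul0r; case: eqP => [eq|_]; last by rewrite path_mul0l.
by rewrite path_mul_elt ?(negPf nr) // is_path_cat eq; apply/andP.
Qed.

Fact path_mul1l : left_id path_one (@path_mul k Q).
Proof.
move=> f; elim/path_alg_ind: f => [|f g If Ig|c f If|p].
- by rewrite path_mul0r.
- by rewrite path_mulDr If Ig.
- by rewrite path_mulZr If.
rewrite (big_morph (fun f : path_alg => path_mul f _)
  (fun _ _ => path_mulDl _ _ _) (path_mul0l _)).
have pP : is_path (qsource p) (qarrows p) := valP p.
rewrite (bigD1 (qtarget p)) //= path_mul_elt // eqxx cats0 big1 ?addr0 // => x.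
by rewrite eq_sym path_mul_elt // => /negPf ->.
Qed.

Fact path_mul1r : right_id path_one (@path_mul k Q).
Proof.
move=> f; elim/path_alg_ind: f => [|f g If Ig|c f If|p].
- by rewrite path_mul0l.
- by rewrite path_mulDl If Ig.
- by rewrite path_mulZl If.
rewrite (big_morph (fun f : path_alg => path_mul _ f)
  (fun _ _ => path_mulDr _ _ _) (path_mul0r _)).
have pP : is_path (qsource p) (qarrows p) := valP p.
rewrite (bigD1 (qsource p)) //= path_mul_elt // eqxx big1 ?addr0 // => x.
by rewrite path_mul_elt // => /negPf /= ->.
Qed.

HB.instance Definition _ := GRing.Zmodule_isPzRing.Build path_alg
  path_mulA path_mul1l path_mul1r path_mulDl path_mulDr.

Fact path_scaleAl (c : k) (f g : path_alg) : c *: (f * g) = (c *: f) * g.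
Proof. by rewrite [RHS]path_mulZl. Qed.

Fact path_scaleAr (c : k) (f g : path_alg) : c *: (f * g) = f * (c *: g).
Proof. by rewrite [RHS]path_mulZr. Qed.

End PathAlgebra.

Section IdealQuotient.
Variables (k : fieldType) (Q : quiver).
Notation A := (path_alg k Q).
Variable R : A -> Prop.

Inductive ideal_gen : A -> Prop :=
| ideal_gen_in x of R x : ideal_gen x
| ideal_gen0 : ideal_gen 0
| ideal_genD x y of ideal_gen x & ideal_gen y : ideal_gen (x + y)
| ideal_genMl a x of ideal_gen x : ideal_gen (a * x)
| ideal_genMr x a of ideal_gen x : ideal_gen (x * a).

Definition ideal_pred : pred A := fun x => `[< ideal_gen x >].

Lemma ideal_predP x : reflect (ideal_gen x) (x \in ideal_pred).
Proof. exact: asboolP. Qed.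

Lemma ideal_pred_zmod_closed : zmod_closed ideal_pred.
Proof.
split=> [|x y /ideal_predP Ix /ideal_predP Iy]; apply/ideal_predP.
  exact: ideal_gen0.
by apply: ideal_genD Ix _; rewrite -mulN1r; apply: ideal_genMl.
Qed.

HB.instance Definition _ :=
  GRing.isZmodClosed.Build A ideal_pred ideal_pred_zmod_closed.

Definition ideal_zmod : zmodClosed A := GRing.ZmodClosed.clone A ideal_pred _.

Definition quot_alg := Quotient.quot ideal_zmod.

HB.instance Definition _ := Choice.on quot_alg.
HB.instance Definition _ := GRing.Zmodule.on quot_alg.

Definition quot_pi (x : A) : quot_alg := \pi_(Quotient.quot ideal_zmod)%qT x.

Lemma quot_piP x y : quot_pi x = quot_pi y <-> ideal_gen (x - y).
Proof.
split=> [/eqP|/ideal_predP]; rewrite /quot_pi.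
  by rewrite -Quotient.idealrBE => /ideal_predP.
by rewrite Quotient.idealrBE => /eqP.
Qed.

Lemma quot_piD : {morph quot_pi : x y / x + y}.
Proof. by move=> x y; rewrite /quot_pi raddfD. Qed.

Lemma quot_pi_surj (u : quot_alg) : exists x, u = quot_pi x.
Proof. by exists (repr (u : Quotient.quot ideal_zmod)); rewrite /quot_pi reprK. Qed.

Definition quot_lift (u : quot_alg) : A := repr (u : Quotient.quot ideal_zmod).

Lemma quot_liftK : cancel quot_lift quot_pi.
Proof. by move=> u; rewrite /quot_pi /quot_lift reprK. Qed.

Definition quot_mul (u v : quot_alg) := quot_pi (quot_lift u * quot_lift v).
Definition quot_scale (c : k) (u : quot_alg) := quot_pi (c *: quot_lift u).

Lemma quot_piM x y : quot_mul (quot_pi x) (quot_pi y) = quot_pi (x * y).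
Proof.
apply/quot_piP; set x' := quot_lift _; set y' := quot_lift _.
have Ix : ideal_gen (x' - x) by apply/quot_piP; rewrite quot_liftK.
have Iy : ideal_gen (y' - y) by apply/quot_piP; rewrite quot_liftK.
have -> : x' * y' - x * y = (x' - x) * y' + x * (y' - y).
  by rewrite mulrBl mulrBr addrA subrK.
by apply: ideal_genD; [apply: ideal_genMr|apply: ideal_genMl].
Qed.

Lemma quot_piZ c x : quot_scale c (quot_pi x) = quot_pi (c *: x).
Proof.
apply/quot_piP; rewrite -scalerBr -[_ - _]mul1r path_scaleAl.
by apply/ideal_genMl/quot_piP; rewrite quot_liftK.
Qed.

Fact quot_mulA : associative quot_mul.
Proof.
move=> u v w; have [x ->] := quot_pi_surj u; have [y ->] := quot_pi_surj v.
by have [z ->] := quot_pi_surj w; rewrite !quot_piM mulrA.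
Qed.

Fact quot_mul1l : left_id (quot_pi 1) quot_mul.
Proof. by move=> u; have [x ->] := quot_pi_surj u; rewrite quot_piM mul1r. Qed.

Fact quot_mul1r : right_id (quot_pi 1) quot_mul.
Proof. by move=> u; have [x ->] := quot_pi_surj u; rewrite quot_piM mulr1. Qed.

Fact quot_mulDl : left_distributive quot_mul +%R.
Proof.
move=> u v w; have [x ->] := quot_pi_surj u; have [y ->] := quot_pi_surj v.
have [z ->] := quot_pi_surj w.
by rewrite -quot_piD !quot_piM -quot_piD mulrDl.
Qed.

Fact quot_mulDr : right_distributive quot_mul +%R.
Proof.
move=> u v w; have [x ->] := quot_pi_surj u; have [y ->] := quot_pi_surj v.
have [z ->] := quot_pi_surj w.
by rewrite -quot_piD !quot_piM -quot_piD mulrDr.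
Qed.

HB.instance Definition _ := GRing.Zmodule_isPzRing.Build quot_alg
  quot_mulA quot_mul1l quot_mul1r quot_mulDl quot_mulDr.

Fact quot_scaleA a b u : quot_scale a (quot_scale b u) = quot_scale (a * b) u.
Proof. by have [x ->] := quot_pi_surj u; rewrite !quot_piZ scalerA. Qed.

Fact quot_scale1 : left_id 1 quot_scale.
Proof. by move=> u; have [x ->] := quot_pi_surj u; rewrite quot_piZ scale1r. Qed.

Fact quot_scaleDr : right_distributive quot_scale +%R.
Proof.
move=> a u v; have [x ->] := quot_pi_surj u; have [y ->] := quot_pi_surj v.
by rewrite -quot_piD !quot_piZ -quot_piD scalerDr.
Qed.

Fact quot_scaleDl u : {morph quot_scale^~ u : a b / a + b}.
Proof.
move=> a b; have [x ->] := quot_pi_surj u.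
by rewrite !quot_piZ -quot_piD scalerDl.
Qed.

HB.instance Definition _ := GRing.Zmodule_isLmodule.Build k quot_alg
  quot_scaleA quot_scale1 quot_scaleDr quot_scaleDl.

Lemma quot_pi1 : quot_pi 1 = 1. Proof. by []. Qed.

Lemma quot_pi_mul : {morph quot_pi : x y / x * y}.
Proof. by move=> x y; rewrite -quot_piM. Qed.

Lemma quot_pi_scale c : {morph quot_pi : x / c *: x}.
Proof. by move=> x; rewrite -quot_piZ. Qed.

Lemma quot_scaleAl (c : k) (u v : quot_alg) : c *: (u * v) = (c *: u) * v.
Proof.
have [x ->] := quot_pi_surj u; have [y ->] := quot_pi_surj v.
by rewrite -quot_pi_mul -!quot_pi_scale -quot_pi_mul path_scaleAl.
Qed.

Lemma quot_scaleAr (c : k) (u v : quot_alg) : c *: (u * v) = u * (c *: v).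
Proof.
have [x ->] := quot_pi_surj u; have [y ->] := quot_pi_surj v.
by rewrite -quot_pi_mul -!quot_pi_scale -quot_pi_mul path_scaleAr.
Qed.

End IdealQuotient.

Section OppositeModule.
Variables (k : fieldType) (Q : quiver) (R : path_alg k Q -> Prop).

HB.instance Definition _ := GRing.Lmodule.copy (quot_alg R)^c (quot_alg R).

End OppositeModule.

Section Blocks.
Variables (T : finType) (P : {set {set T}}).
Hypothesis partP : partition P [set: T].

Lemma block_in (x : T) : pblock P x \in P.
Proof. by rewrite pblock_mem // (cover_partition partP) inE. Qed.

Definition block (x : T) : {B : {set T} | B \in P} :=
  Sub (pblock P x) (block_in x).

Lemma block_inh (B : {B : {set T} | B \in P}) : exists x, x \in val B.
Proof.
case: B => B BP; have /and3P[_ _ P0] := partP; apply/set0Pn.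
by apply: contraNneq P0 => /= <-.
Qed.

Definition block_rep (B : {B : {set T} | B \in P}) : T := xchoose (block_inh B).

Lemma block_repP (B : {B : {set T} | B \in P}) : block_rep B \in val B.
Proof. exact: (xchooseP (block_inh B)). Qed.

Lemma block_eq (B : {B : {set T} | B \in P}) x : x \in val B -> block x = B.
Proof.
move=> xB; apply/val_inj/def_pblock => //; first by have /and3P[] := partP.
exact: valP.
Qed.

Lemma block_repK B : block (block_rep B) = B.
Proof. exact/block_eq/block_repP. Qed.

End Blocks.

(* A finite fractional Brauer configuration on the finite set E.  An action   *)
(* of the infinite cyclic group <g> is given by the permutation by which g    *)
(* acts, so g^n . e is [iter n g e].  P(e) and L(e) are the blocks            *)
(* [pblock P e] and [pblock L e]; finiteness of P(e) in (f1) is automatic.    *)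
(* In (f6) the formal sequences are listed from their last term to the first. *)
Record fbconfig (E : finType) := FBConfig {
  fb_g : {perm E};
  fb_P : {set {set E}};
  fb_L : {set {set E}};
  fb_d : E -> nat;
  fb_P_partition : partition fb_P [set: E];
  fb_L_partition : partition fb_L [set: E];
  fb_d_gt0 : forall e, (0 < fb_d e)%N;
  fb_f1 : forall e, pblock fb_L e \subset pblock fb_P e;
  fb_f2 : forall e1 e2, pblock fb_L e1 = pblock fb_L e2 ->
    pblock fb_P (fb_g e1) = pblock fb_P (fb_g e2);
  fb_f3 : forall e1 e2, e2 \in porbit fb_g e1 -> fb_d e1 = fb_d e2;
  fb_f4 : forall e1 e2, pblock fb_P e1 = pblock fb_P e2 <->
    pblock fb_P (iter (fb_d e1) fb_g e1) = pblock fb_P (iter (fb_d e2) fb_g e2);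
  fb_f5 : forall e1 e2, pblock fb_L e1 = pblock fb_L e2 <->
    pblock fb_L (iter (fb_d e1) fb_g e1) = pblock fb_L (iter (fb_d e2) fb_g e2);
  fb_f6 : forall e h,
    let Lseq x := [seq pblock fb_L (iter i fb_g x) | i <- iota 0 (fb_d x)] in
    ~~ (infix (Lseq e) (Lseq h) && (Lseq e != Lseq h))
}.

Section FractionalBrauer.
Variables (k : fieldType) (E : finType) (F : fbconfig E).

Local Notation g := (fb_g F).
Local Notation d := (fb_d F).

Definition type_MS : Prop := forall e, pblock (fb_L F) e = [set e].

Definition integral_fdegree : Prop := forall e, (#|porbit g e| %| d e)%N.

Definition fb_Pcl : E -> {B : {set E} | B \in fb_P F} :=
  block (fb_P_partition F).
Definition fb_Lcl : E -> {B : {set E} | B \in fb_L F} :=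
  block (fb_L_partition F).

(* The arrow L(e) goes from P(e) to P(g . e) whatever the representative of   *)
(* L(e); see [fb_source] and [fb_target].                                     *)
Definition fb_quiver : quiver :=
  let rep := block_rep (fb_L_partition F) in
  Quiver (fun a => fb_Pcl (rep a)) (fun a => fb_Pcl (g (rep a))).

Lemma fb_Lrep e :
  pblock (fb_L F) (block_rep (fb_L_partition F) (fb_Lcl e)) = pblock (fb_L F) e.
Proof. exact: (congr1 val (block_repK (fb_L_partition F) (fb_Lcl e))). Qed.

Lemma fb_source e : source (fb_Lcl e : arrow fb_quiver) = fb_Pcl e.
Proof.
apply: block_eq => /=.
exact: subsetP (fb_f1 F e) _ (block_repP (fb_L_partition F) (fb_Lcl e)).
Qed.

Lemma fb_target e : target (fb_Lcl e : arrow fb_quiver) = fb_Pcl (g e).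
Proof. exact/val_inj/fb_f2/fb_Lrep. Qed.

(* The path L(g^(n-1) . e) ... L(g . e) L(e) as an element of k Q_E; the      *)
(* trivial path at P(e) if n = 0.                                             *)
Definition fb_arrows (e : E) (n : nat) : seq (arrow fb_quiver) :=
  [seq fb_Lcl (iter i g e) | i <- iota 0 n].
Definition fb_path (e : E) (n : nat) : path_alg k fb_quiver :=
  path_elt k (fb_Pcl e : vertex fb_quiver) (fb_arrows e n).

Lemma fb_arrowsS e n :
  fb_arrows e n.+1 = (fb_Lcl e : arrow fb_quiver) :: fb_arrows (g e) n.
Proof.
rewrite /fb_arrows /= -[1%N]/(1 + 0)%N iotaDl -map_comp; congr (_ :: _).
by apply: eq_map => i /=; rewrite -iterSr.
Qed.

Lemma fb_arrows_is_path e n :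
  is_path (fb_Pcl e : vertex fb_quiver) (fb_arrows e n).
Proof.
elim: n e => // n IHn e; rewrite fb_arrowsS.
by apply/andP; split; [apply/eqP/fb_source|rewrite fb_target].
Qed.

Inductive fb_relation : path_alg k fb_quiver -> Prop :=
| fR1 (e h : E) (n : nat) of (n <= minn (d e) (d h))%N
    & pblock (fb_P F) e = pblock (fb_P F) h
    & (forall i, (1 <= i <= n)%N ->
        pblock (fb_L F) (iter (d e - i) g e)
        = pblock (fb_L F) (iter (d h - i) g h)) :
    fb_relation (fb_path e (d e - n) - fb_path h (d h - n))
| fR2 (x : vertex fb_quiver) (s : seq (arrow fb_quiver))
    of is_path x s & (1 < size s)%N
    & \bigcap_(i < size s)
        [set iter (size s - i.+1) g y | y in nth set0 (map val s) i] = set0 :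
    fb_relation (path_elt k x s)
| fR3 (e : E) (n : nat) of (d e < n)%N : fb_relation (fb_path e n).

(* The category k Q_E and its ideal I_E are replaced by the path algebra      *)
(* (the sum of all morphism spaces) and the two-sided ideal generated by the  *)
(* same elements; the quotient is then the sum of the spaces Lambda_E(x, y).  *)
Definition fb_Lambda := quot_alg fb_relation.
Definition fb_alg := fb_Lambda^c.

End FractionalBrauer.

(* All the conditions on a Brauer configuration except the last one, which is *)
(* [is_brauer_config] below: a Brauer configuration is a D : brauer_data with *)
(* is_brauer_config D.  The algebra makes sense without the last condition,   *)
(* but the condition matters: k[x]/(x^2) is A_E for E = {e} with d(e) = 1,    *)
(* and it is not the algebra of a Brauer configuration, since a non-zero      *)
(* Brauer configuration algebra has dimension at least 3.                     *)
Record brauer_data (D0 D1 : finType) := BrauerData {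
  bc_zeta : D1 -> D0;
  bc_P : {set {set D1}};
  bc_p : {perm D1};
  bc_nu : D0 -> nat;
  bc_zeta_surj : forall a, exists e, bc_zeta e = a;
  bc_P_partition : partition bc_P [set: D1];
  bc_P_ge2 : forall e, (2 <= #|pblock bc_P e|)%N;
  bc_p_cycles : porbits bc_p = [set bc_zeta @^-1: [set a] | a : D0];
  bc_nu_gt0 : forall a, (0 < bc_nu a)%N
}.

Section Brauer.
Variables (k : fieldType) (D0 D1 : finType) (D : brauer_data D0 D1).

Local Notation zeta := (bc_zeta D).
Local Notation p := (bc_p D).
Local Notation nu := (bc_nu D).

Definition is_brauer_config : Prop :=
  forall e, exists2 h, h \in pblock (bc_P D) e
    & (1 < #|zeta @^-1: [set zeta h]| * nu (zeta h))%N.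

Definition bc_Pcl : D1 -> {B : {set D1} | B \in bc_P D} :=
  block (bc_P_partition D).

Definition bc_quiver : quiver :=
  @Quiver {B : {set D1} | B \in bc_P D} D1 bc_Pcl (fun e => bc_Pcl (p e)).

Definition bc_arrow (e : D1) : path_alg k bc_quiver :=
  path_elt k (bc_Pcl e : vertex bc_quiver) [:: (e : arrow bc_quiver)].

(* [bc_cycle e] is p(e) : one turn of the cycle of e, starting with e.        *)
Definition bc_arrows (e : D1) (n : nat) : seq (arrow bc_quiver) :=
  [seq (iter i p e : arrow bc_quiver) | i <- iota 0 n].
Definition bc_cycle (e : D1) : path_alg k bc_quiver :=
  path_elt k (bc_Pcl e : vertex bc_quiver) (bc_arrows e #|porbit p e|).

Lemma bc_arrowsS e n :
  bc_arrows e n.+1 = (e : arrow bc_quiver) :: bc_arrows (p e) n.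
Proof.
rewrite /bc_arrows /= -[1%N]/(1 + 0)%N iotaDl -map_comp; congr (_ :: _).
by apply: eq_map => i /=; rewrite -iterSr.
Qed.

Lemma bc_arrows_is_path e n :
  is_path (bc_Pcl e : vertex bc_quiver) (bc_arrows e n).
Proof.
elim: n e => // n IHn e; rewrite bc_arrowsS.
by apply/andP; split; [apply/eqP|apply: IHn].
Qed.

Inductive bc_relation : path_alg k bc_quiver -> Prop :=
| bcR1 (e h : D1) of pblock (bc_P D) e = pblock (bc_P D) h :
    bc_relation (bc_cycle e ^+ nu (zeta e) - bc_cycle h ^+ nu (zeta h))
| bcR2 (e1 e2 : D1) of bc_Pcl (p e1) = bc_Pcl e2 & e2 <> p e1 :
    bc_relation (bc_arrow e2 * bc_arrow e1).

Definition bc_alg := quot_alg bc_relation.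

End Brauer.

(* Main.v *)
Require Import Defs.
From HB Require Import structures.
From mathcomp Require Import all_boot all_fingroup all_algebra.
From mathcomp Require Import finmap monalg.

Set Implicit Arguments.
Unset Strict Implicit.
Unset Printing Implicit Defensive.

Import GRing.Theory.
Local Open Scope ring_scope.

(** If E is of type MS, its arrows are its elements, and an integral f-degree
means that d(e) is a multiple of the size of the orbit of e, hence that
g^d(e) fixes e.  The special path of length d(e) at e is then a power of the
cycle of e.  Relation (fR1) has content only for k = 0, where it equates these
cycle powers over each class of P, and this is (R1); for k > 0 it forces e = h.
Relation (fR2) kills exactly the paths in which some arrow is not followed by
its g-successor, and this is (R2).  So A_E looks like a Brauer configuration
algebra with the angles E, except for two points.

Direction.  A_E is the opposite of the quotient of the path algebra, whereas
Brauer configuration algebras are not opposed.  The permutation of the Brauer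
configuration is therefore the inverse of g, and the arrow L(e) corresponds to
the angle g.e.

Classes with one element.  A Brauer configuration has at least two angles in
each class.  To a class {e} of E one adds an angle fixed by the permutation, of
multiplicity 1.  By (R1) the corresponding loop equals the cycle power of e, so
it is a redundant generator, and its products with the other arrows vanish as
they already do for the cycle power.  Conversely, when every class has two
elements e, h, relation (fR3) follows from (R1) and (R2): the cycle power of e
equals that of h, whose last arrow cannot be followed by the arrow e
[bc_path_long].

Both halves of the theorem are instances of one comparison, [fb_bc_iso], for an
embedding of E into the angles of a Brauer configuration whose image contains
everything but loops of this kind: the padded configuration [pad_data] for the
first half, and the identity of the set of angles for the second [bc_fbconfig].
The comparison builds two mutually inverse anti-homomorphisms between the two
quotients of path algebras.  Each is defined on vertices and arrows by the
universal property of path algebras [antirep], descends because it kills the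
relations [fb_antirep_rel, bc_antirep_rel], and they are inverse to each other
because an endomorphism is determined on generators [quot_endo_id]. *)

(** * Generators of a quotient of a path algebra *)

Section Generators.
Variables (k : fieldType) (Q : quiver) (R : path_alg k Q -> Prop).

Definition vertex_elt (x : vertex Q) : quot_alg R :=
  quot_pi R (path_elt k x [::]).

Definition arrow_elt (a : arrow Q) : quot_alg R :=
  quot_pi R (path_elt k (source a) [:: a]).

Definition qpath_elt (x : vertex Q) (s : seq (arrow Q)) : quot_alg R :=
  quot_pi R (path_elt k x s).

Lemma quot_pi0 : quot_pi R 0 = 0.
Proof. by rewrite -[in LHS](scale0r 0) quot_pi_scale scale0r. Qed.

Lemma quot_pi_eq0 x : quot_pi R x = 0 <-> ideal_gen R x.
Proof. by rewrite -quot_pi0 quot_piP subr0. Qed.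

Lemma path_elt_cat (x : vertex Q) s t : is_path x (s ++ t) ->
  path_elt k x (s ++ t) = path_elt k (path_end x s) t * path_elt k x s.
Proof.
rewrite is_path_cat => /andP[sP tP]; rewrite /GRing.mul /=.
by rewrite path_mul_elt // eqxx.
Qed.

Lemma qpath_elt_cons x a s : is_path x (a :: s) ->
  qpath_elt x (a :: s) = qpath_elt (target a) s * arrow_elt a.
Proof.
move=> asP; have /andP[/eqP ex _] := asP.
by rewrite /qpath_elt -cat1s path_elt_cat //= quot_pi_mul -ex.
Qed.

Lemma qpath_elt_cat x s t : is_path x (s ++ t) ->
  qpath_elt x (s ++ t) = qpath_elt (path_end x s) t * qpath_elt x s.
Proof. by move=> stP; rewrite /qpath_elt path_elt_cat // quot_pi_mul. Qed.

Lemma qpath_elt_mul0 x s y t : path_end x s != y ->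
  qpath_elt y t * qpath_elt x s = 0.
Proof.
move=> nxy; rewrite -quot_pi_mul.
case: (boolP (is_path x s)) => [sP|/(path_eltN k) ->]; last first.
  by rewrite mulr0 quot_pi0.
case: (boolP (is_path y t)) => [tP|/(path_eltN k) ->]; last first.
  by rewrite mul0r quot_pi0.
have -> : path_elt k y t * path_elt k x s = 0.
  by rewrite /GRing.mul /= path_mul_elt // (negPf nxy).
exact: quot_pi0.
Qed.

Lemma vertex_eltM x y :
  vertex_elt x * vertex_elt y = if x == y then vertex_elt x else 0.
Proof.
case: (eqVneq x y) => [->|nxy]; first by rewrite -[LHS](@qpath_elt_cat y [::]).
by apply: (@qpath_elt_mul0 y [::] x [::]); rewrite eq_sym.
Qed.

Lemma vertex_elt_sum : \sum_x vertex_elt x = 1.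
Proof.
rewrite -quot_pi1 /GRing.one /= /path_one.
by rewrite (big_morph (quot_pi R) (@quot_piD k Q R) quot_pi0).
Qed.

Lemma vertex_qpath x s :
  is_path x s -> vertex_elt (path_end x s) * qpath_elt x s = qpath_elt x s.
Proof.
by move=> sP; rewrite -[LHS](@qpath_elt_cat x s [::]) cats0.
Qed.

Lemma qpath_vertex x s :
  is_path x s -> qpath_elt x s * vertex_elt x = qpath_elt x s.
Proof. by move=> sP; rewrite -[LHS](@qpath_elt_cat x [::] s). Qed.

Lemma vertex_arrow a : vertex_elt (target a) * arrow_elt a = arrow_elt a.
Proof. by rewrite [LHS](@vertex_qpath (source a) [:: a]) //= eqxx. Qed.

Lemma arrow_vertex a : arrow_elt a * vertex_elt (source a) = arrow_elt a.
Proof. by rewrite [LHS](@qpath_vertex (source a) [:: a]) //= eqxx. Qed.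

Lemma quot_endo_id (chi : {linear quot_alg R -> quot_alg R}) :
    {morph chi : u v / u * v} ->
    (forall x, chi (vertex_elt x) = vertex_elt x) ->
    (forall a, chi (arrow_elt a) = arrow_elt a) ->
  chi =1 id.
Proof.
move=> chiM chi_v chi_a u; have [f ->] := quot_pi_surj u.
elim/path_alg_ind: f => [|f g If Ig|c f If|[[x s] /= sP]].
- by rewrite quot_pi0 linear0.
- by rewrite quot_piD linearD If Ig.
- by rewrite quot_pi_scale linearZ_LR If.
rewrite /qsource /qarrows /=; elim: s x sP => [|a s IHs] x sP.
  exact: chi_v.
have /andP[_ tsP] := sP.
by rewrite -/(qpath_elt x (a :: s)) qpath_elt_cons // chiM [chi _]IHs // chi_a.
Qed.

End Generators.

(** * The universal property of path algebras *)

(** The values prescribed on vertices and arrows are multiplied in the order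
of traversal, so paths, which compose from right to left, give an
anti-homomorphism. *)
Section AntiRepresentation.
Variables (k : fieldType) (Q Q' : quiver) (R' : path_alg k Q' -> Prop).
Notation B := (quot_alg R').
Variables (eps : vertex Q -> B) (alpha : arrow Q -> B).
Hypothesis epsM : forall x y, eps x * eps y = if x == y then eps x else 0.
Hypothesis eps_sum : \sum_x eps x = 1.
Hypothesis eps_alpha : forall a, eps (source a) * alpha a = alpha a.
Hypothesis alpha_eps : forall a, alpha a * eps (target a) = alpha a.

Fixpoint path_value (x : vertex Q) (s : seq (arrow Q)) : B :=
  if s is a :: s' then alpha a * path_value (target a) s' else eps x.

Lemma eps_path_value x s :
  is_path x s -> eps x * path_value x s = path_value x s.
Proof.
case: s => [|a s] /=; first by rewrite epsM eqxx.
by case/andP=> /eqP <- _; rewrite mulrA eps_alpha.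
Qed.

Lemma path_value_eps x s :
  path_value x s * eps (path_end x s) = path_value x s.
Proof.
elim: s x => [|a s IHs] x /=; first by rewrite epsM eqxx.
by rewrite -mulrA IHs.
Qed.

Lemma path_value_cat x s t : is_path x (s ++ t) ->
  path_value x (s ++ t) = path_value x s * path_value (path_end x s) t.
Proof.
elim: s x => [|a s IHs] x /=; first by move=> tP; rewrite eps_path_value.
by case/andP=> _ /IHs ->; rewrite mulrA.
Qed.

Lemma path_value_mul0 x s y t : path_end x s != y -> is_path y t ->
  path_value x s * path_value y t = 0.
Proof.
move=> nxy tP; rewrite -path_value_eps -(eps_path_value tP) mulrA.
by rewrite -[_ * eps y]mulrA epsM (negPf nxy) mulr0 mul0r.
Qed.

Definition antirep (f : path_alg k Q) : B :=
  \sum_(p <- msupp f) f@_p *: path_value (qsource p) (qarrows p).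

Lemma antirep_wide (d : {fset qpath Q}) (f : path_alg k Q) :
    (msupp f `<=` d)%fset ->
  antirep f = \sum_(p <- d) f@_p *: path_value (qsource p) (qarrows p).
Proof.
move=> le; rewrite /antirep; apply: big_fset_incl => // p _ /mcoeff_outdom ->.
by rewrite scale0r.
Qed.

Fact antirep_linear : linear antirep.
Proof.
move=> c f g; set d := (msupp f `|` msupp g)%fset.
have lef : (msupp f `<=` d)%fset by apply: fsubsetUl.
have leg : (msupp g `<=` d)%fset by apply: fsubsetUr.
rewrite (antirep_wide lef) (antirep_wide leg) (@antirep_wide d); last first.
  apply: fsubset_trans (msuppD_le _ _) _; rewrite fsubUset leg andbT.
  exact: fsubset_trans (msupp_pathZ_le _ _) lef.
rewrite scaler_sumr -big_split /=; apply: eq_bigr => p _.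
by rewrite mcoeffD mcoeff_pathZ scalerDl scalerA.
Qed.

HB.instance Definition _ :=
  GRing.isLinear.Build k (path_alg k Q) B *:%R antirep antirep_linear.

Lemma antirep_elt x s :
  is_path x s -> antirep (path_elt k x s) = path_value x s.
Proof.
move=> sP; rewrite path_elt_ok.
rewrite (@antirep_wide [fset (Sub (x, s) sP : qpath Q)]%fset) ?msuppU_le //.
by rewrite big_seq_fset1 mcoeffUU scale1r.
Qed.

Lemma antirepM f g : antirep (f * g) = antirep g * antirep f.
Proof.
elim/path_alg_ind: f => [|f f' If If'|c f If|p].
- by rewrite mul0r linear0 mulr0.
- by rewrite mulrDl !linearD /= mulrDr If If'.
- by rewrite -path_scaleAl !linearZ_LR /= If quot_scaleAr.
elim/path_alg_ind: g => [|f f' If If'|c f If|q].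
- by rewrite mulr0 linear0 mul0r.
- by rewrite mulrDr !linearD /= mulrDl If If'.
- by rewrite -path_scaleAr !linearZ_LR /= If quot_scaleAl.
have pP : is_path (qsource p) (qarrows p) := valP p.
have qP : is_path (qsource q) (qarrows q) := valP q.
rewrite [_ * path_elt _ _ _]path_mul_elt // !antirep_elt //.
case: eqP => [eqp|/eqP nqp]; last by rewrite linear0 path_value_mul0.
have qpP : is_path (qsource q) (qarrows q ++ qarrows p).
  by rewrite is_path_cat qP eqp.
by rewrite antirep_elt // path_value_cat // eqp.
Qed.

Lemma antirep1 : antirep 1 = 1.
Proof.
rewrite -eps_sum {1}/GRing.one /= /path_one linear_sum.
by apply: eq_bigr => x _; rewrite /= antirep_elt.
Qed.

Variable R : path_alg k Q -> Prop.
Hypothesis antirep_R : forall f, R f -> antirep f = 0.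

Lemma antirep_ideal f : ideal_gen R f -> antirep f = 0.
Proof.
elim=> [g /antirep_R //||g h _ Ig _ Ih|a g _ Ig|g a _ Ig].
- exact: linear0.
- by rewrite linearD /= Ig Ih addr0.
- by rewrite antirepM Ig mul0r.
- by rewrite antirepM Ig mulr0.
Qed.

Definition quot_antirep (u : quot_alg R) : B := antirep (quot_lift u).

Lemma quot_antirepE f : quot_antirep (quot_pi R f) = antirep f.
Proof.
apply/eqP; rewrite -subr_eq0 -linearB; apply/eqP/antirep_ideal/quot_piP.
exact: quot_liftK.
Qed.

Fact quot_antirep_linear : linear quot_antirep.
Proof.
move=> c u v; have [f ->] := quot_pi_surj u; have [g ->] := quot_pi_surj v.
by rewrite -quot_pi_scale -quot_piD !quot_antirepE linearP.
Qed.

HB.instance Definition _ :=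
  GRing.isLinear.Build k (quot_alg R) B *:%R quot_antirep quot_antirep_linear.

Lemma quot_antirepM u v :
  quot_antirep (u * v) = quot_antirep v * quot_antirep u.
Proof.
have [f ->] := quot_pi_surj u; have [g ->] := quot_pi_surj v.
by rewrite -quot_pi_mul !quot_antirepE antirepM.
Qed.

Lemma quot_antirep1 : quot_antirep 1 = 1.
Proof. by rewrite -quot_pi1 quot_antirepE antirep1. Qed.

Lemma quot_antirep_path x s :
  is_path x s -> quot_antirep (qpath_elt R x s) = path_value x s.
Proof. by move=> sP; rewrite quot_antirepE antirep_elt. Qed.

Lemma quot_antirep_vertex x : quot_antirep (vertex_elt R x) = eps x.
Proof. exact: quot_antirep_path. Qed.

Lemma quot_antirep_arrow a : quot_antirep (arrow_elt R a) = alpha a.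
Proof. by rewrite [LHS]quot_antirep_path /= ?eqxx ?alpha_eps. Qed.

End AntiRepresentation.

(** * Paths in a Brauer configuration algebra *)

Section BrauerPaths.
Variables (k : fieldType) (D0 D1 : finType) (D : brauer_data D0 D1).
Local Notation p := (bc_p D).
Local Notation P := (bc_P D).
Local Notation A := (bc_alg k D).
Local Notation rel := (@bc_relation k D0 D1 D).

(** The length of the path p(x)^nu in relation (R1); it corresponds to d. *)
Definition bc_turn (x : D1) : nat := #|porbit p x| * bc_nu D (bc_zeta D x).

Definition bc_path (x : D1) (n : nat) : A :=
  qpath_elt rel (bc_Pcl D x : vertex (bc_quiver D)) (bc_arrows D x n).

Lemma bc_arrowsD x m n :
  bc_arrows D x (m + n) = bc_arrows D x m ++ bc_arrows D (iter m p x) n.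
Proof.
elim: m x => [|m IHm] x //; rewrite addSn !bc_arrowsS IHm /=.
by rewrite -iterS iterSr.
Qed.

Lemma bc_arrows_end x n :
  path_end (bc_Pcl D x : vertex (bc_quiver D)) (bc_arrows D x n)
  = bc_Pcl D (iter n p x).
Proof. by elim: n x => // n IHn x; rewrite bc_arrowsS /= IHn -iterS iterSr. Qed.

Lemma bc_pathD x m n : bc_path x (m + n) = bc_path (iter m p x) n * bc_path x m.
Proof.
rewrite /bc_path bc_arrowsD qpath_elt_cat ?bc_arrows_end //.
by rewrite -bc_arrowsD bc_arrows_is_path.
Qed.

Lemma bc_pathSl x n : bc_path x n.+1 =
  arrow_elt rel (iter n p x : arrow (bc_quiver D)) * bc_path x n.
Proof. by rewrite -addn1 bc_pathD. Qed.

Lemma bc_turn_gt0 x : (0 < bc_turn x)%N.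
Proof. by rewrite muln_gt0 bc_nu_gt0 lt0n card_porbit_neq0. Qed.

Lemma iter_bc_turn x : iter (bc_turn x) p x = x.
Proof.
rewrite /bc_turn mulnC; elim: (bc_nu _ _) => // n IHn.
by rewrite mulSn iterD IHn iter_porbit.
Qed.

Lemma bc_cycleX x n : (0 < n)%N -> bc_cycle k D x ^+ n =
  path_elt k (bc_Pcl D x : vertex (bc_quiver D))
    (bc_arrows D x (#|porbit p x| * n)).
Proof.
case: n => // n _; elim: n => [|n IHn]; first by rewrite muln1 expr1.
have fixx : iter (#|porbit p x| * n.+1) p x = x.
  rewrite mulnC; elim: n.+1 => // m IHm.
  by rewrite mulSn iterD IHm iter_porbit.
rewrite exprS IHn (mulnSr _ n.+1) bc_arrowsD fixx path_elt_cat.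
  by rewrite bc_arrows_end fixx.
have := bc_arrows_is_path D x (#|porbit p x| * n.+1 + #|porbit p x|).
by rewrite bc_arrowsD fixx.
Qed.

Lemma bc_path_turn_eq x y :
  pblock P x = pblock P y -> bc_path x (bc_turn x) = bc_path y (bc_turn y).
Proof.
move=> Pxy; apply/quot_piP/ideal_gen_in.
by rewrite -!bc_cycleX ?bc_nu_gt0 //; apply: bcR1.
Qed.

Lemma bc_arrow_mul0 (x y : arrow (bc_quiver D)) : y <> p x ->
  arrow_elt rel y * arrow_elt rel x = 0.
Proof.
move=> nyx; case: (eqVneq (bc_Pcl D (p x)) (bc_Pcl D y)) => [Pxy|nPxy].
  by rewrite -quot_pi_mul; apply/quot_pi_eq0/ideal_gen_in/bcR2.
exact: qpath_elt_mul0.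
Qed.

(** The class of x contains some h different from x.  The power of the cycle of
x equals that of h, and the last arrow of the latter precedes only h. *)
Lemma bc_path_long x n : (bc_turn x < n)%N -> bc_path x n = 0.
Proof.
move=> lt_xn; suff x0 : bc_path x (bc_turn x).+1 = 0.
  by rewrite -(subnKC lt_xn) bc_pathD x0 mulr0.
have [h] : exists h, h \in pblock P x :\ x.
  apply/card_gt0P; have := bc_P_ge2 D x.
  by rewrite (cardsD1 x) mem_pblock (cover_partition (bc_P_partition D)) inE.
case/setD1P => nhx Ph.
have trivP : trivIset P by have /and3P[] := bc_P_partition D.
have {}Ph : pblock P x = pblock P h by apply/esym/same_pblock.
rewrite bc_pathSl iter_bc_turn (bc_path_turn_eq Ph).
have ph := iter_bc_turn h; have := bc_turn_gt0 h.
case: (bc_turn h) ph => // m ph _; rewrite bc_pathSl.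
rewrite mulrA bc_arrow_mul0 ?mul0r //.
by move=> xh; case/eqP: nhx; rewrite -ph xh.
Qed.

End BrauerPaths.

(** * Paths in the algebra of a fractional Brauer configuration *)

Section FractionalBrauerPaths.
Variables (k : fieldType) (E : finType) (F : fbconfig E).
Hypotheses (F_MS : type_MS F) (F_int : integral_fdegree F).
Local Notation g := (fb_g F).
Local Notation d := (fb_d F).
Local Notation P := (fb_P F).
Local Notation A := (fb_Lambda k F).
Local Notation rel := (@fb_relation k E F).

Definition fb_rep (a : arrow (fb_quiver F)) : E :=
  block_rep (fb_L_partition F) a.

Lemma fb_repK a : fb_Lcl F (fb_rep a) = a.
Proof. exact: block_repK. Qed.

Lemma fb_LclK e : fb_rep (fb_Lcl F e) = e.
Proof.
have := block_repP (fb_L_partition F) (fb_Lcl F e).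
by rewrite /= F_MS => /set1P.
Qed.

Definition fb_arrow (e : E) : A :=
  arrow_elt rel (fb_Lcl F e : arrow (fb_quiver F)).

Definition fb_qpath (e : E) (n : nat) : A :=
  qpath_elt rel (fb_Pcl F e : vertex (fb_quiver F)) (fb_arrows F e n).

Lemma fb_Pcl_eq e h : (fb_Pcl F e = fb_Pcl F h) <-> (pblock P e = pblock P h).
Proof. by split=> [/(congr1 val)|Peh] //; apply: val_inj. Qed.

Lemma fb_arrowsD e m n :
  fb_arrows F e (m + n) = fb_arrows F e m ++ fb_arrows F (iter m g e) n.
Proof.
elim: m e => [|m IHm] e //; rewrite addSn !fb_arrowsS IHm /=.
by rewrite -iterS iterSr.
Qed.

Lemma fb_arrows_end e n :
  path_end (fb_Pcl F e : vertex (fb_quiver F)) (fb_arrows F e n)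
  = fb_Pcl F (iter n g e).
Proof.
elim: n e => // n IHn e; rewrite fb_arrowsS.
rewrite -[LHS]/(path_end (target (fb_Lcl F e : arrow (fb_quiver F))) _).
by rewrite fb_target IHn -iterSr.
Qed.

Lemma fb_qpathD e m n :
  fb_qpath e (m + n) = fb_qpath (iter m g e) n * fb_qpath e m.
Proof.
rewrite /fb_qpath fb_arrowsD qpath_elt_cat ?fb_arrows_end //.
by rewrite -fb_arrowsD fb_arrows_is_path.
Qed.

Lemma fb_qpath1 e : fb_qpath e 1 = fb_arrow e.
Proof. by rewrite /fb_arrow /arrow_elt fb_source. Qed.

Lemma fb_qpathSl e n : fb_qpath e n.+1 = fb_arrow (iter n g e) * fb_qpath e n.
Proof. by rewrite -addn1 fb_qpathD fb_qpath1. Qed.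

Lemma fb_qpathSr e n : fb_qpath e n.+1 = fb_qpath (g e) n * fb_arrow e.
Proof. by rewrite -add1n fb_qpathD fb_qpath1. Qed.

Lemma iter_fb_d e : iter (d e) g e = e.
Proof.
have /dvdnP[q ->] := F_int e; elim: q => // q IHq.
by rewrite mulSn iterD IHq iter_porbit.
Qed.

Lemma fb_d_g e : d (g e) = d e.
Proof. by apply/esym/fb_f3; apply: (mem_porbit g 1). Qed.

Lemma fb_qpath_d_eq e h :
  pblock P e = pblock P h -> fb_qpath e (d e) = fb_qpath h (d h).
Proof.
move=> Peh; apply/quot_piP/ideal_gen_in.
by rewrite -[d e]subn0 -[d h]subn0; apply: fR1 => // -[].
Qed.

Lemma fb_qpath_long e n : (d e < n)%N -> fb_qpath e n = 0.
Proof. by move=> lt_en; apply/quot_pi_eq0/ideal_gen_in/fR3. Qed.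

Lemma fb_arrow_mul0 e h : h <> g e -> fb_arrow h * fb_arrow e = 0.
Proof.
move=> nhe; rewrite -!fb_qpath1.
case: (eqVneq (fb_Pcl F (g e)) (fb_Pcl F h)) => [Peh|nPeh]; last first.
  by apply: qpath_elt_mul0; rewrite (fb_arrows_end e 1).
have ehP : is_path (fb_Pcl F e : vertex (fb_quiver F))
    [:: (fb_Lcl F e : arrow (fb_quiver F)); fb_Lcl F h].
  by apply/and3P; rewrite !fb_source fb_target Peh.
rewrite /fb_qpath -Peh -(fb_arrows_end e 1) -[LHS]qpath_elt_cat //.
apply/quot_pi_eq0/ideal_gen_in/fR2 => //.
rewrite 2!big_ord_recl big_ord0 setIT /= !F_MS !imset_set1 /=.
by apply/setP => x; rewrite !inE; apply/andP => -[/eqP -> /eqP/esym].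
Qed.

(** Together with [fb_arrows_bigcap] this shows that the paths in (fR2) are
those with a break, so that only products of two arrows matter. *)
Lemma fb_arrows_or_break (a : arrow (fb_quiver F)) s :
  (exists e, a :: s = fb_arrows F e (size s).+1) \/
  (exists s1 b c s2, a :: s = s1 ++ b :: c :: s2 /\ fb_rep c <> g (fb_rep b)).
Proof.
elim: s a => [|b s IHs] a.
  by left; exists (fb_rep a); rewrite fb_arrowsS fb_repK.
case: (eqVneq (fb_rep b) (g (fb_rep a))) => [gab|/eqP ngab]; last first.
  by right; exists [::], a, b, s.
case: (IHs b) => [[e bsE]|[s1 [c [c' [s2 [bsE ncc']]]]]]; last first.
  by right; exists (a :: s1), c, c', s2; rewrite bsE.
left; exists (fb_rep a); rewrite fb_arrowsS fb_repK -gab; congr (_ :: _).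
have [bE _] : b :: s =
    (fb_Lcl F e : arrow (fb_quiver F)) :: fb_arrows F (g e) (size s).
  by rewrite bsE fb_arrowsS.
by rewrite [LHS]bsE bE fb_LclK.
Qed.

Lemma fb_arrows_bigcap e n :
  \bigcap_(i < n.+1) [set iter (n.+1 - i.+1) g y
    | y in nth set0 (map val (fb_arrows F e n.+1)) i] != set0.
Proof.
apply/set0Pn; exists (iter n g e); apply/bigcapP => i _.
have lt_in := ltn_ord i.
rewrite (nth_map (fb_Lcl F e)) ?size_map ?size_iota //.
rewrite (nth_map 0%N) ?size_iota // nth_iota // add0n /= F_MS imset_set1 inE.
by rewrite -iterD subSS subnK.
Qed.

End FractionalBrauerPaths.

(** * Comparison of the two algebras *)

Section Comparison.
Variables (k : fieldType) (E : finType) (F : fbconfig E).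
Variables (D0 D1 : finType) (D : brauer_data D0 D1).
Hypotheses (F_MS : type_MS F) (F_int : integral_fdegree F).
Local Notation g := (fb_g F).
Local Notation d := (fb_d F).
Local Notation p := (bc_p D).
Local Notation turn := (bc_turn D).
Local Notation L := (fb_Lambda k F).
Local Notation B := (bc_alg k D).

(** E is embedded by emb in the set of angles.  The angles outside of its image
are loops equal, by (R1), to the cycle power of an element of E in the same
class; ret chooses this element, and inverts emb on its image. *)
Variables (emb : E -> D1) (ret : D1 -> E).
Hypothesis embK : cancel emb ret.
Hypothesis emb_g : forall e, p (emb (g e)) = emb e.
Hypothesis emb_d : forall e, d e = turn (emb e).
Hypothesis emb_P : forall e h,
  pblock (fb_P F) e = pblock (fb_P F) h <->
  pblock (bc_P D) (emb e) = pblock (bc_P D) (emb h).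
Hypothesis ret_P : forall x, pblock (bc_P D) (emb (ret x)) = pblock (bc_P D) x.
Hypothesis truncated : forall x, emb (ret x) != x -> p x = x /\ turn x = 1%N.

Definition fb_to_bc_vertex (X : vertex (fb_quiver F)) : vertex (bc_quiver D) :=
  bc_Pcl D (emb (block_rep (fb_P_partition F) X)).

Definition bc_to_fb_vertex (Y : vertex (bc_quiver D)) : vertex (fb_quiver F) :=
  fb_Pcl F (ret (block_rep (bc_P_partition D) Y)).

Lemma bc_Pcl_eq x y :
  (bc_Pcl D x = bc_Pcl D y) <-> (pblock (bc_P D) x = pblock (bc_P D) y).
Proof. by split=> [/(congr1 val)|Pxy] //; apply: val_inj. Qed.

Lemma fb_to_bc_Pcl e : fb_to_bc_vertex (fb_Pcl F e) = bc_Pcl D (emb e).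
Proof.
apply/bc_Pcl_eq/emb_P/fb_Pcl_eq; exact: block_repK.
Qed.

Lemma bc_to_fb_Pcl x : bc_to_fb_vertex (bc_Pcl D x) = fb_Pcl F (ret x).
Proof.
apply/fb_Pcl_eq/emb_P; rewrite !ret_P; apply/bc_Pcl_eq; exact: block_repK.
Qed.

Lemma fb_to_bc_vertexK : cancel fb_to_bc_vertex bc_to_fb_vertex.
Proof.
move=> X; rewrite -[X in RHS](block_repK (fb_P_partition F) X).
by rewrite [LHS]bc_to_fb_Pcl embK.
Qed.

Lemma bc_to_fb_vertexK : cancel bc_to_fb_vertex fb_to_bc_vertex.
Proof.
move=> Y; rewrite -[Y in RHS](block_repK (bc_P_partition D) Y).
by rewrite [LHS]fb_to_bc_Pcl; apply/bc_Pcl_eq/ret_P.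
Qed.

Local Notation brel := (@bc_relation k D0 D1 D).
Local Notation frel := (@fb_relation k E F).

Definition fb_eps (X : vertex (fb_quiver F)) : B :=
  vertex_elt brel (fb_to_bc_vertex X).
(** In the opposite quiver L(e) goes from P(g.e) to P(e), as does the angle
g.e. *)
Definition fb_alpha (a : arrow (fb_quiver F)) : B :=
  arrow_elt brel (emb (g (fb_rep a)) : arrow (bc_quiver D)).

Definition bc_eps (Y : vertex (bc_quiver D)) : L :=
  vertex_elt frel (bc_to_fb_vertex Y).
(** An angle outside of the image of emb is sent to the cycle power that it
must equal by (R1). *)
Definition bc_alpha (x : arrow (bc_quiver D)) : L :=
  if emb (ret x) == x then fb_arrow k F (g^-1%g (ret x))
  else fb_qpath k F (ret x) (d (ret x)).

Lemma fb_epsM X Y : fb_eps X * fb_eps Y = if X == Y then fb_eps X else 0.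
Proof. by rewrite vertex_eltM (can_eq fb_to_bc_vertexK). Qed.

Lemma bc_epsM X Y : bc_eps X * bc_eps Y = if X == Y then bc_eps X else 0.
Proof. by rewrite vertex_eltM (can_eq bc_to_fb_vertexK). Qed.

Lemma fb_eps_sum : \sum_X fb_eps X = 1.
Proof.
rewrite -(vertex_elt_sum brel) [RHS](reindex fb_to_bc_vertex) //.
exists bc_to_fb_vertex => X _;
  [exact: fb_to_bc_vertexK|exact: bc_to_fb_vertexK].
Qed.

Lemma bc_eps_sum : \sum_X bc_eps X = 1.
Proof.
rewrite -(vertex_elt_sum frel) [RHS](reindex bc_to_fb_vertex) //.
exists fb_to_bc_vertex => X _;
  [exact: bc_to_fb_vertexK|exact: fb_to_bc_vertexK].
Qed.

Lemma fb_eps_alpha a : fb_eps (source a) * fb_alpha a = fb_alpha a.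
Proof.
rewrite /fb_eps [fb_to_bc_vertex _]fb_to_bc_Pcl -/(fb_rep a) -emb_g.
exact: (vertex_arrow brel (emb (g (fb_rep a)) : arrow (bc_quiver D))).
Qed.

Lemma fb_alpha_eps a : fb_alpha a * fb_eps (target a) = fb_alpha a.
Proof.
rewrite /fb_eps [fb_to_bc_vertex _]fb_to_bc_Pcl -/(fb_rep a).
exact: (arrow_vertex brel (emb (g (fb_rep a)) : arrow (bc_quiver D))).
Qed.

Lemma bc_p_emb x : emb (ret x) = x -> p x = emb (g^-1%g (ret x)).
Proof. by move=> {1}<-; rewrite -{1}(permKV g (ret x)) emb_g. Qed.

Lemma ret_bc_p x : emb (ret x) = x -> ret (p x) = g^-1%g (ret x).
Proof. by move=> /bc_p_emb ->. Qed.

Lemma bc_eps_alpha x : bc_eps (source x) * bc_alpha x = bc_alpha x.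
Proof.
rewrite /bc_eps [bc_to_fb_vertex _]bc_to_fb_Pcl /bc_alpha.
case: ifP => _; last first.
  have := vertex_qpath frel (fb_arrows_is_path F (ret x) (d (ret x))).
  by rewrite fb_arrows_end iter_fb_d.
rewrite -[in vertex_elt _ _](permKV g (ret x)) -fb_target; exact: vertex_arrow.
Qed.

Lemma bc_alpha_eps x : bc_alpha x * bc_eps (target x) = bc_alpha x.
Proof.
rewrite /bc_eps [bc_to_fb_vertex _]bc_to_fb_Pcl /bc_alpha.
case: eqVneq => [retx|/truncated[px _]]; last first.
  by rewrite px; apply/qpath_vertex/fb_arrows_is_path.
by rewrite ret_bc_p // -fb_source; apply: arrow_vertex.
Qed.

Local Notation fb_antirep := (antirep fb_eps fb_alpha).
Local Notation bc_antirep := (antirep bc_eps bc_alpha).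
Local Notation fb_value := (path_value fb_eps fb_alpha).
Local Notation bc_value := (path_value bc_eps bc_alpha).

Lemma iter_emb_g n e : iter n p (emb (iter n g e)) = emb e.
Proof. by elim: n e => // n IHn e; rewrite iterSr iterS emb_g IHn. Qed.

Lemma fb_alpha_Lcl e : fb_alpha (fb_Lcl F e) = bc_path k D (emb (g e)) 1.
Proof. by rewrite /fb_alpha fb_LclK. Qed.

Lemma fb_value_arrows e n :
  fb_value (fb_Pcl F e) (fb_arrows F e n) = bc_path k D (emb (iter n g e)) n.
Proof.
elim: n e => [|n IHn] e; first by rewrite /= /fb_eps fb_to_bc_Pcl.
rewrite fb_arrowsS /= [X in fb_value X](fb_target F e) IHn fb_alpha_Lcl.
rewrite -iterSr iterS -(addn1 n) bc_pathD -[g (iter n g e)]iterS iterSr.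
by rewrite iter_emb_g.
Qed.

Lemma fb_value_d e :
  fb_value (fb_Pcl F e) (fb_arrows F e (d e))
  = bc_path k D (emb e) (turn (emb e)).
Proof. by rewrite fb_value_arrows iter_fb_d // emb_d. Qed.

(** The relations become (R1) for (fR1), (R2) for (fR2), and [bc_path_long] for
(fR3). *)
Lemma fb_antirep_rel f : frel f -> fb_antirep f = 0.
Proof.
case=> {f} [e h n le_n Peh tail|x s sP s_gt1 cap|e n lt_en].
- rewrite linearB /= !antirep_elt ?fb_arrows_is_path //.
  case: n le_n tail => [|n] le_n tail.
    rewrite !subn0 !fb_value_d; apply/eqP; rewrite subr_eq0; apply/eqP.
    by apply/bc_path_turn_eq/emb_P.
  (* The last arrows agree, and applying g to them gives e = h. *)
  move: le_n; rewrite leq_min => /andP[le_ne le_nh].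
  suff -> : e = h by rewrite subrr.
  have := tail 1%N isT; rewrite !F_MS !subn1 => /set1_inj/(congr1 g).
  by rewrite -!iterS !prednK ?fb_d_gt0 // !iter_fb_d.
- rewrite antirep_elt //; case: s sP s_gt1 cap => // a s _ _.
  case: (fb_arrows_or_break F_MS a s) => [[e ->]|[s1 [b [c [s2 [-> ncb]]]]] _].
    rewrite /fb_arrows !size_map size_iota => /eqP.
    by rewrite (negPf (fb_arrows_bigcap F_MS e (size s))).
  elim: s1 x => [|c' s1 IHs] x /=; last by rewrite IHs mulr0.
  rewrite mulrA bc_arrow_mul0 ?mul0r // emb_g => /(can_inj embK)/esym.
  exact: ncb.
- rewrite antirep_elt ?fb_arrows_is_path // fb_value_arrows bc_path_long //.
  suff <- : turn (emb e) = turn (emb (iter n g e)) by rewrite -emb_d.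
  by rewrite -!emb_d; apply: fb_f3; rewrite -permX mem_porbit.
Qed.

Lemma bc_alpha_emb e : bc_alpha (emb (g e)) = fb_arrow k F e.
Proof. by rewrite /bc_alpha embK eqxx permK. Qed.

Lemma bc_value_emb e n :
  bc_value (bc_Pcl D (emb (iter n g e))) (bc_arrows D (emb (iter n g e)) n)
  = fb_qpath k F e n.
Proof.
elim: n => [|n IHn]; first by rewrite /= /bc_eps bc_to_fb_Pcl embK.
by rewrite bc_arrowsS /= bc_alpha_emb emb_g IHn fb_qpathSl.
Qed.

Lemma bc_value_turn x :
  bc_value (bc_Pcl D x) (bc_arrows D x (turn x))
  = fb_qpath k F (ret x) (d (ret x)).
Proof.
case: (eqVneq (emb (ret x)) x) => [retx|nretx].
  rewrite -{1 2 3}retx -emb_d -{1 2}(iter_fb_d F_int (ret x)).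
  exact: bc_value_emb.
have [px ->] := truncated nretx.
rewrite /= [X in _ * X]/(bc_eps (target (x : arrow (bc_quiver D)))).
by rewrite bc_alpha_eps /bc_alpha (negPf nretx).
Qed.

(** Two arrows in the image of emb fall under (fR2).  Otherwise one of the
factors is a cycle power, which can be rotated within its class to a cycle
power continued by the other factor; the product is then a path too long not to
vanish by (fR3). *)
Lemma bc_alpha_mul0 x y : pblock (bc_P D) (p x) = pblock (bc_P D) y ->
  y <> p x -> bc_alpha x * bc_alpha y = 0.
Proof.
move=> Pxy nyx; rewrite /bc_alpha.
case: eqVneq => [retx|/truncated[px _]]; case: eqVneq => [rety|_].
- apply: fb_arrow_mul0 => //; rewrite permKV => retxy; apply: nyx.
  by rewrite bc_p_emb // retxy rety.
- have Pe : pblock (fb_P F) (ret y) = pblock (fb_P F) (g^-1%g (ret x)).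
    by apply/emb_P; rewrite ret_P -Pxy bc_p_emb.
  rewrite (fb_qpath_d_eq k Pe); set e := (g^-1%g _).
  by rewrite -{1}(iter_fb_d F_int e) -fb_qpathSl fb_qpath_long.
- have Pe : pblock (fb_P F) (ret x) = pblock (fb_P F) (ret y).
    by apply/emb_P; rewrite !ret_P -Pxy px.
  rewrite (fb_qpath_d_eq k Pe); set e := (g^-1%g _).
  by rewrite -[ret y](permKV g) -/e fb_d_g -fb_qpathSr fb_qpath_long.
- have Pe : pblock (fb_P F) (ret x) = pblock (fb_P F) (ret y).
    by apply/emb_P; rewrite !ret_P -Pxy px.
  rewrite (fb_qpath_d_eq k Pe) -{1}(iter_fb_d F_int (ret y)) -fb_qpathD.
  by rewrite fb_qpath_long // -[ltnLHS]addn0 ltn_add2l fb_d_gt0.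
Qed.

Lemma bc_antirep_rel f : brel f -> bc_antirep f = 0.
Proof.
case=> {f} [x y Pxy|x y Pxy nyx].
- rewrite linearB /= !bc_cycleX ?bc_nu_gt0 //.
  rewrite !antirep_elt ?bc_arrows_is_path //.
  rewrite ![path_value _ _ _ _]bc_value_turn.
  apply/eqP; rewrite subr_eq0; apply/eqP.
  by apply/fb_qpath_d_eq/emb_P; rewrite !ret_P.
rewrite (antirepM bc_epsM bc_eps_alpha).
rewrite !antirep_elt /= ?eqxx // !bc_alpha_eps.
by apply: bc_alpha_mul0 => //; apply/bc_Pcl_eq.
Qed.

Local Notation phi := (quot_antirep fb_eps fb_alpha (R := frel)).
Local Notation psi := (quot_antirep bc_eps bc_alpha (R := brel)).

Lemma fb_to_bcM u v : phi (u * v) = phi v * phi u.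
Proof.
exact: (quot_antirepM fb_epsM fb_eps_alpha fb_antirep_rel).
Qed.

Lemma bc_to_fbM u v : psi (u * v) = psi v * psi u.
Proof.
exact: (quot_antirepM bc_epsM bc_eps_alpha bc_antirep_rel).
Qed.

Lemma fb_bc_iso :
  exists (f : {linear fb_alg k F -> bc_alg k D})
         (f' : {linear bc_alg k D -> fb_alg k F}),
  [/\ monoid_morphism f, monoid_morphism f', cancel f f' & cancel f' f].
Proof.
have phi_lin := quot_antirep_linear fb_epsM fb_eps_alpha fb_antirep_rel.
have psi_lin := quot_antirep_linear bc_epsM bc_eps_alpha bc_antirep_rel.
pose f : {linear L -> B} := HB.pack_for {linear L -> B} (phi : L -> B)
  (GRing.isLinear.Build k L B *:%R phi phi_lin).
pose f' : {linear B -> L} := HB.pack_for {linear B -> L} (psi : B -> L)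
  (GRing.isLinear.Build k B L *:%R psi psi_lin).
have f_v X : phi (vertex_elt frel X) = fb_eps X.
  exact: (quot_antirep_vertex fb_epsM fb_eps_alpha fb_antirep_rel).
have f_a a : phi (arrow_elt frel a) = fb_alpha a.
  exact: (quot_antirep_arrow fb_epsM fb_eps_alpha fb_alpha_eps fb_antirep_rel).
have f'_v X : psi (vertex_elt brel X) = bc_eps X.
  exact: (quot_antirep_vertex bc_epsM bc_eps_alpha bc_antirep_rel).
have f'_a a : psi (arrow_elt brel a) = bc_alpha a.
  exact: (quot_antirep_arrow bc_epsM bc_eps_alpha bc_alpha_eps bc_antirep_rel).
have f_path e n :
    phi (fb_qpath k F e n) = fb_value (fb_Pcl F e) (fb_arrows F e n).
  apply: (quot_antirep_path fb_epsM fb_eps_alpha fb_antirep_rel).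
  exact: fb_arrows_is_path.
have fK : cancel f f'.
  apply: (@quot_endo_id _ _ _ (f' \o f)) => [u v|X|a] /=.
  - by rewrite fb_to_bcM bc_to_fbM.
  - by rewrite f_v f'_v /bc_eps fb_to_bc_vertexK.
  - by rewrite f_a f'_a bc_alpha_emb /fb_arrow fb_repK.
have f'K : cancel f' f.
  apply: (@quot_endo_id _ _ _ (f \o f')) => [u v|X|x] /=.
  - by rewrite bc_to_fbM fb_to_bcM.
  - by rewrite f'_v f_v /fb_eps bc_to_fb_vertexK.
  rewrite f'_a /bc_alpha; case: eqVneq => [retx|nretx].
    by rewrite f_a fb_alpha_Lcl // permKV retx.
  have [_ turnx] := truncated nretx.
  by rewrite f_path fb_value_d (bc_path_turn_eq k (ret_P x)) turnx.
exists f, f'; split=> //; split=> [|u v].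
- exact: (quot_antirep1 fb_epsM fb_eps_sum fb_eps_alpha fb_antirep_rel).
- exact: fb_to_bcM.
- exact: (quot_antirep1 bc_epsM bc_eps_sum bc_eps_alpha bc_antirep_rel).
- exact: bc_to_fbM.
Qed.

End Comparison.

(** * The Brauer configuration of a fractional one *)

Section PreimPartition.
Variables (T : finType) (rT : eqType) (f : T -> rT).
Local Notation P := (preim_partition f [set: T]).

Lemma mem_preim_pblock x y : (y \in pblock P x) = (f x == f y).
Proof. by rewrite pblock_equivalence_partition ?inE //; split=> // /eqP ->. Qed.

Lemma preim_pblock_eq x y : pblock P x = pblock P y <-> f x = f y.
Proof.
have PT := preim_partitionP f [set: T].
have trivP : trivIset P by have /and3P[] := PT.
split=> [Pxy|fxy]; last first.
  by apply/same_pblock => //; rewrite mem_preim_pblock fxy.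
by apply/eqP; rewrite -mem_preim_pblock Pxy mem_pblock (cover_partition PT) inE.
Qed.

End PreimPartition.

Lemma pblock_preim_id (T : finType) (x : T) :
  pblock (preim_partition id [set: T]) x = [set x].
Proof. by apply/setP => y; rewrite mem_preim_pblock inE eq_sym. Qed.

Section Padding.
Variables (E : finType) (F : fbconfig E).
Hypothesis F_int : integral_fdegree F.
Local Notation g := (fb_g F).
Local Notation d := (fb_d F).

Local Notation lone := {e : E | #|pblock (fb_P F) e| == 1%N}.
(** The elements of E, and a new angle for each class of P with one element. *)
Definition padded : finType := (E + lone)%type.

Definition pad_own (x : padded) : E :=
  match x with inl e => e | inr u => val u end.

Definition pad_P : {set {set padded}} :=
  preim_partition (fun x => pblock (fb_P F) (pad_own x)) [set: padded].

Definition pad_next (x : padded) : padded :=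
  match x with inl e => inl (g^-1%g e) | inr u => inr u end.

Lemma pad_next_inj : injective pad_next.
Proof. by move=> [e|u] [h|v] //= [/perm_inj ->]. Qed.

Definition pad_p : {perm padded} := perm pad_next_inj.

Definition pad_turn (x : padded) : nat := if x is inl e then d e else 1%N.

Lemma pad_pX_inl i e : (pad_p ^+ i)%g (inl e) = inl ((g^-1 ^+ i)%g e).
Proof.
elim: i => [|i IHi]; first by rewrite !expg0 !perm1.
by rewrite !expgSr !permM IHi permE.
Qed.

Lemma pad_pX_inr i u : (pad_p ^+ i)%g (inr u) = inr u.
Proof.
elim: i => [|i IHi]; first by rewrite expg0 perm1.
by rewrite expgSr permM IHi permE.
Qed.

Lemma pad_porbit_inl e : porbit pad_p (inl e) = inl @: porbit g e.
Proof.
apply/setP => x; rewrite -(porbitV g).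
apply/porbitP/imsetP => [[i ->]|[h /porbitP[i ->] ->]].
  by rewrite pad_pX_inl; exists ((g^-1 ^+ i)%g e); rewrite ?mem_porbit.
by exists i; rewrite pad_pX_inl.
Qed.

Lemma pad_porbit_inr u : porbit pad_p (inr u) = [set inr u].
Proof.
apply/setP => x; rewrite inE; apply/porbitP/eqP => [[i ->]|->].
  exact: pad_pX_inr.
by exists 0%N; rewrite pad_pX_inr.
Qed.

Lemma pad_turn_dvd x : (#|porbit pad_p x| %| pad_turn x)%N.
Proof.
case: x => [e|u]; last by rewrite pad_porbit_inr cards1.
by rewrite pad_porbit_inl card_imset // => h h' [].
Qed.

Lemma pad_turn_orbit x y : y \in porbit pad_p x -> pad_turn y = pad_turn x.
Proof.
case: x => [e|u].
  by rewrite pad_porbit_inl => /imsetP[h he ->]; apply/esym/fb_f3.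
by rewrite pad_porbit_inr => /set1P ->.
Qed.

Definition pad_vertex : finType := {C : {set padded} | C \in porbits pad_p}.

Definition pad_zeta (x : padded) : pad_vertex :=
  Sub (porbit pad_p x) (imset_f (porbit pad_p) (isT : x \in predT)).

(** The maximum is taken over equal numbers: it is a way to read off the value
at any element of the cycle. *)
Definition pad_nu (C : pad_vertex) : nat :=
  \max_(x in val C) (pad_turn x %/ #|porbit pad_p x|).

Lemma pad_zetaV (C : pad_vertex) : pad_zeta @^-1: [set C] = val C.
Proof.
apply/setP => x; rewrite !inE; case: C => C CP; have /imsetP[y _ CE] := CP.
by rewrite -(inj_eq val_inj) /= CE eq_porbit_mem.
Qed.

Lemma pad_nuE x : (#|porbit pad_p x| * pad_nu (pad_zeta x))%N = pad_turn x.
Proof.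
suff -> : pad_nu (pad_zeta x) = (pad_turn x %/ #|porbit pad_p x|)%N.
  by rewrite mulnC divnK ?pad_turn_dvd.
have same y : y \in porbit pad_p x -> (pad_turn y %/ #|porbit pad_p y|)%N
    = (pad_turn x %/ #|porbit pad_p x|)%N.
  move=> xy; rewrite (pad_turn_orbit xy); congr (_ %/ #|pred_of_set _|)%N.
  by apply/eqP; rewrite eq_porbit_mem.
apply/eqP; rewrite eqn_leq /pad_nu /=; apply/andP; split.
  by apply/bigmax_leqP => y /same ->.
exact: (leq_bigmax_cond _ (porbit_id pad_p x)).
Qed.

Lemma pad_zeta_surj C : exists x, pad_zeta x = C.
Proof.
case: C => C CP; have /imsetP[x _ CE] := CP; exists x; exact: val_inj.
Qed.

Lemma pad_P_ge2 x : (2 <= #|pblock pad_P x|)%N.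
Proof.
have inP y : pblock (fb_P F) (pad_own y) = pblock (fb_P F) (pad_own x) ->
    y \in pblock pad_P x.
  by move=> Pyx; rewrite mem_preim_pblock Pyx.
apply/card_gt1P.
case: (eqVneq #|pblock (fb_P F) (pad_own x)| 1%N) => [one|none].
  exists (inl (pad_own x)), (inr (Sub (pad_own x) (introT eqP one))).
  by split=> //; apply: inP.
have trivP : trivIset (fb_P F) by have /and3P[] := fb_P_partition F.
have : (1 < #|pblock (fb_P F) (pad_own x)|)%N.
  rewrite ltn_neqAle eq_sym none card_gt0; apply/set0Pn; exists (pad_own x).
  by rewrite mem_pblock (cover_partition (fb_P_partition F)) inE.
case/card_gt1P => h1 [h2 [Ph1 Ph2 nh]].
by exists (inl h1), (inl h2); split=> //; apply: inP; apply: same_pblock.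
Qed.

Lemma pad_p_cycles :
  porbits pad_p = [set pad_zeta @^-1: [set C] | C : pad_vertex].
Proof.
apply/setP => C; apply/idP/imsetP => [CP|[C' _ ->]]; last first.
  by rewrite pad_zetaV (valP C').
by exists (Sub C CP); rewrite ?pad_zetaV.
Qed.

Lemma pad_nu_gt0 C : (0 < pad_nu C)%N.
Proof.
have [x <-] := pad_zeta_surj C; have : (0 < pad_turn x)%N.
  by case: x => //= e; apply: fb_d_gt0.
by rewrite -pad_nuE muln_gt0 => /andP[].
Qed.

Definition pad_data : brauer_data pad_vertex padded :=
  @BrauerData pad_vertex padded pad_zeta pad_P pad_p pad_nu pad_zeta_surj
    (preim_partitionP _ _) pad_P_ge2 pad_p_cycles pad_nu_gt0.

Lemma pad_is_brauer_config :
    (forall e, exists2 h, h \in pblock (fb_P F) e & (1 < d h)%N) ->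
  is_brauer_config pad_data.
Proof.
move=> Fd x; have [h Ph d_gt1] := Fd (pad_own x); exists (inl h).
  have trivP : trivIset (fb_P F) by have /and3P[] := fb_P_partition F.
  by rewrite mem_preim_pblock (same_pblock trivP Ph).
by rewrite pad_zetaV pad_nuE.
Qed.

Lemma pad_iso (k : fieldType) : type_MS F ->
  exists (f : {linear fb_alg k F -> bc_alg k pad_data})
         (f' : {linear bc_alg k pad_data -> fb_alg k F}),
  [/\ monoid_morphism f, monoid_morphism f', cancel f f' & cancel f' f].
Proof.
move=> F_MS.
apply: (@fb_bc_iso k E F _ _ pad_data F_MS F_int inl pad_own) => //.
- by move=> e; rewrite permE /= permK.
- by move=> e; rewrite /bc_turn pad_nuE.
- move=> e h; exact: iff_sym (preim_pblock_eq _ (inl e) (inl h)).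
- by move=> x; apply/preim_pblock_eq.
- case=> [e|u] /=; first by rewrite eqxx.
  by rewrite permE /bc_turn pad_nuE.
Qed.

End Padding.

(** * The fractional Brauer configuration of a Brauer configuration *)

Section BrauerToFractional.
Variables (D0 D1 : finType) (D : brauer_data D0 D1).
Local Notation p := (bc_p D).
Local Notation turn := (bc_turn D).
Local Notation g := (p^-1)%g.
Local Notation L := (preim_partition id [set: D1]).

Lemma bc_zeta_porbit x y : y \in porbit p x -> bc_zeta D y = bc_zeta D x.
Proof.
have : porbit p x \in porbits p by apply: imset_f.
rewrite bc_p_cycles => /imsetP[a _ xE] xy.
by have := porbit_id p x; move: xy; rewrite xE !inE => /eqP -> /eqP.
Qed.

Lemma bc_turn_porbit x y : y \in porbit p x -> turn y = turn x.
Proof.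
move=> xy; rewrite /bc_turn (bc_zeta_porbit xy); congr (#|pred_of_set _| * _)%N.
by apply/eqP; rewrite eq_porbit_mem.
Qed.

Lemma iter_turnV x : iter (turn x) g x = x.
Proof.
rewrite -{2}(iter_bc_turn D x); elim: (turn x) => // n IHn.
by rewrite iterSr iterS permK.
Qed.

Fact bc_fb_f1 e : pblock L e \subset pblock (bc_P D) e.
Proof.
rewrite pblock_preim_id sub1set mem_pblock.
by rewrite (cover_partition (bc_P_partition D)) inE.
Qed.

Fact bc_fb_f2 e1 e2 : pblock L e1 = pblock L e2 ->
  pblock (bc_P D) (g e1) = pblock (bc_P D) (g e2).
Proof. by move/preim_pblock_eq => ->. Qed.

Fact bc_fb_f3 e1 e2 : e2 \in porbit g e1 -> turn e1 = turn e2.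
Proof. by rewrite porbitV => /bc_turn_porbit. Qed.

(** Conditions (f4) and (f5) say the same thing about the two partitions, and
hold because going d(e) steps from e returns to e. *)
Fact bc_fb_f45 (P : {set {set D1}}) e1 e2 : pblock P e1 = pblock P e2 <->
  pblock P (iter (turn e1) g e1) = pblock P (iter (turn e2) g e2).
Proof. by rewrite !iter_turnV. Qed.

(** If the sequence of e occurs in that of h, then e is in the orbit of h, and
the two sequences have the same length. *)
Fact bc_fb_f6 e h :
  let Lseq x := [seq pblock L (iter i g x) | i <- iota 0 (turn x)] in
  ~~ (infix (Lseq e) (Lseq h) && (Lseq e != Lseq h)).
Proof.
set Lseq := fun x => _; apply/negP => /andP[/infixP[s [s' hE]] /eqP]; case.
have eh : pblock L e \in Lseq h.
  rewrite hE !mem_cat; apply/orP; right; apply/orP; left.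
  by apply/mapP; exists 0%N; rewrite // mem_iota bc_turn_gt0.
have {eh} turn_eh : turn e = turn h.
  case/mapP: eh => i _ /preim_pblock_eq /= ->; apply/esym/bc_fb_f3.
  by rewrite -permX mem_porbit.
have := congr1 size hE; rewrite !size_cat !size_map !size_iota turn_eh.
rewrite addnCA -[LHS]addn0 => /addnI/esym/eqP; rewrite addn_eq0 !size_eq0.
by case/andP=> /eqP s0 /eqP s'0; rewrite hE s0 s'0 cats0.
Qed.

Definition bc_fbconfig : fbconfig D1 :=
  @FBConfig D1 g (bc_P D) L turn (bc_P_partition D) (preim_partitionP _ _)
    (bc_turn_gt0 D) bc_fb_f1 bc_fb_f2 bc_fb_f3 (bc_fb_f45 _) (bc_fb_f45 _)
    bc_fb_f6.

Lemma bc_fbconfig_MS : type_MS bc_fbconfig.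
Proof. exact: pblock_preim_id. Qed.

Lemma bc_fbconfig_int : integral_fdegree bc_fbconfig.
Proof. by move=> e; rewrite porbitV dvdn_mulr. Qed.

Lemma bc_fbconfig_iso (k : fieldType) :
  exists (f : {linear fb_alg k bc_fbconfig -> bc_alg k D})
         (f' : {linear bc_alg k D -> fb_alg k bc_fbconfig}),
  [/\ monoid_morphism f, monoid_morphism f', cancel f f' & cancel f' f].
Proof.
apply: (@fb_bc_iso k D1 bc_fbconfig D0 D1 D _ _ id id) => //.
- exact: bc_fbconfig_MS.
- exact: bc_fbconfig_int.
- by move=> e; rewrite permKV.
- by move=> x; rewrite eqxx.
Qed.

End BrauerToFractional.

Theorem corollary6p7 (k : closedFieldType) :
  (forall (E : finType) (F : fbconfig E),
     type_MS F -> integral_fdegree F ->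
     exists (D0 D1 : finType) (D : brauer_data D0 D1),
       ((forall e : E, exists2 h, h \in pblock (fb_P F) e & (1 < fb_d F h)%N) ->
          is_brauer_config D)
       /\ exists f : {linear fb_alg k F -> bc_alg k D},
            monoid_morphism f /\ bijective f)
  /\
  (forall (D0 D1 : finType) (D : brauer_data D0 D1),
     is_brauer_config D ->
     exists (E : finType) (F : fbconfig E),
       [/\ type_MS F, integral_fdegree F
         & exists f : {linear bc_alg k D -> fb_alg k F},
             monoid_morphism f /\ bijective f]).
Proof.
split=> [E F F_MS F_int|D0 D1 D _].
  exists (pad_vertex F), (padded F), (pad_data F_int).
  split; first exact: pad_is_brauer_config.
  have [f [f' [fM _ fK f'K]]] := pad_iso F_int k F_MS.
  by exists f; split=> //; exists f'.
exists D1, (bc_fbconfig D).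
split; [exact: bc_fbconfig_MS|exact: bc_fbconfig_int|].
have [f [f' [_ f'M fK f'K]]] := bc_fbconfig_iso D k.
by exists f'; split=> //; exists f.
Qed.
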